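(* Let $(M,g,\nabla^M)$ and $(N,h,\nabla^N)$ be statistical manifolds such that $(N,h,\overline\nabla^N)$ is a Hessian manifold with Hessian curvature tensor field $\overline H$. Then for every smooth map $u:(M,g,\nabla^M)\to(N,h,\nabla^N)$, $$\mathcal H_u(V)=\overline H(\tau(u),\tau(u);V),\qquad V\in\Gamma(u^{-1}TN).$$ In particular, if $(N,h,\overline\nabla^N)$ has constant Hessian curvature $c$, then $\langle\mathcal H_u(V),V\rangle=-c\cdot h(\tau(u),V)^2$ for all $V\in\Gamma(u^{-1}TN)$.
   Context: All objects are smooth. A statistical manifold $(M,g,\nabla)$ is a Riemannian manifold with a torsion-free affine connection such that $(\nabla_Xg)(Y,Z)=(\nabla_Yg)(X,Z)$. $\nabla^g$ is the Levi-Civita connection. The difference tensor is $K_XY=K(X,Y)=\nabla_XY-\nabla^g_XY$. The conjugate connection $\overline\nabla$ is defined by $Xg(Y,Z)=g(\nabla_XY,Z)+g(Y,\overline\nabla_XZ)$; $(M,g,\overline\nabla)$ is again a statistical manifold. Curvature: $R(X,Y)Z=\nabla_X\nabla_YZ-\nabla_Y\nabla_XZ-\nabla_{[X,Y]}Z$; $\overline R$ is the curvature of $\overline\nabla$. The tensor $L$ is defined by $g(L(Z,W)X,Y)=g(R(X,Y)Z,W)$, and $\bar L$ is the same tensor built from $\overline R$. Superscripts $M,N$ indicate the manifold. A Hessian manifold is a statistical manifold $(M,g,\nabla)$ with $R=0$. Its Hessian curvature tensor field is $H(Y,Z;X)=(\nabla_XK)(Y,Z)$, where $K=\nabla-\nabla^g$;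 it has constant Hessian curvature $c\in\mathbb R$ if $H(Y,Z;X)=-\frac c2(g(X,Y)Z+g(X,Z)Y)$ for all $X,Y,Z$. (Thus $\overline H$ is built from $\overline\nabla^N$ and the difference tensor $\overline\nabla^N-\nabla^h$.) For a smooth map $u:(M,g,\nabla^M)\to(N,h,\nabla^N)$, $\nabla^u$ and $\overline\nabla^u$ are the connections on $u^{-1}TN$ induced from $\nabla^N$ and $\overline\nabla^N$, and $\langle\cdot,\cdot\rangle$ is the fiber metric induced by $h$. With $\{e_i\}$ a local $g$-orthonormal frame: $\tau(u)=\sum_i(\nabla^u_{e_i}u_*e_i-u_*\nabla^M_{e_i}e_i)$; $\overline\tau(u)=\sum_i(\overline\nabla^u_{e_i}u_*e_i-u_*\overline\nabla^M_{e_i}e_i)$; and $$\begin{aligned}\mathcal H_u(V)=&\ \overline R^N(V,\overline\tau(u))\tau(u)+\sum_i(\overline\nabla^N_{u_*e_i}\overline R^N)(V,u_*e_i)\tau(u)+2\sum_i\overline R^N(V,u_*e_i)\overline\nabla^u_{e_i}\tau(u)\\&+\sum_i(\overline\nabla^N_V\bar L^N)(\tau(u),u_*e_i)u_*e_i-2\sum_iL^N(u_*e_i,\tau(u))\overline\nabla^u_{e_i}V-(\overline\nabla^N_VK^N)(\tau(u),\tau(u)).\end{aligned}$$ *)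

(* Defs.v *)
From HB Require Import structures.
From mathcomp Require Import all_boot all_order all_algebra.
From mathcomp Require Import boolp classical_sets functions cardinality reals interval_inference topology.
From mathcomp Require Import normedtype landau derive.
From mathcomp Require Import ring.
Set Implicit Arguments.
Unset Strict Implicit.
Unset Printing Implicit Defensive.
Import Order.TTheory GRing.Theory Num.Theory numFieldNormedType.Exports.
Local Open Scope classical_set_scope.
Local Open Scope ring_scope.

(* f is C^k on the open set U; its values outside U are irrelevant. *)
Fixpoint Ck (R : realType) (V W : normedModType R) (k : nat) (U : set V)
    (f : V -> W) : Prop :=
  if k is k'.+1 then
    (forall x, U x -> differentiable f x) /\ forall v, Ck k' U ('D_v f)
  else forall x, U x -> {for x, continuous f}.

Definition smooth_on (R : realType) (V W : normedModType R) (U : set V)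
  (f : V -> W) := forall k, Ck k U f.

Lemma near_eq_differentiable (R : realType) (V W : normedModType R)
    (f g : V -> W) x :
  (\near x, f x = g x) -> differentiable f x -> differentiable g x.
Proof.
move=> fg df; rewrite -[g](subrK f) addrC; apply: differentiableD => //.
have z0 : \forall y \near x, (g - f) y = 0.
  by near=> y; rewrite !fctE (near fg y) ?subrr.
have z1 : \forall y \near (0 : V), (g - f) (y + x) = 0.
  by move: z0; rewrite (near_shift 0 x) subr0.
have xz : (g - f) \o shift x = cst ((g - f) x) + cst 0 +o_ 0 id.
  apply/eqaddoP => _/posnumP[e]; near=> y.
  have -> : ((g - f) \o shift x - (cst ((g - f) x) + cst 0)) y =
      (g - f) (y + x) - ((g - f) x + 0) by [].
  have -> : (g - f) (y + x) = 0 by near: y.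
  by rewrite (nbhs_singleton z0) addr0 subr0 normr0 mulr_ge0.
have zE : 'd (g - f) x = 0 :> (V -> W).
  by apply: (@diff_unique _ V W (g - f) \0 x) => // ?; exact: cst_continuous.
apply/diff_locallyP; rewrite zE; split=> // ?; exact: cst_continuous.
Unshelve. all: by end_near. Qed.

Section Ck_lemmas.
Variables (R : realType) (V : normedModType R).

Lemma Ck_eq (W : normedModType R) k (U : set V) (f g : V -> W) :
  open U -> (forall x, U x -> f x = g x) -> Ck k U f -> Ck k U g.
Proof.
move=> oU.
have nU (f' g' : V -> W) : (forall x, U x -> f' x = g' x) ->
    forall x, U x -> \near x, f' x = g' x.
  move=> fg x Ux; near=> y; apply: fg; near: y; exact: open_nbhs_nbhs.
elim: k f g => [|k IH] f g fg /=.
  move=> cf x Ux; rewrite /prop_for /continuous_at -(fg x Ux).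
  apply: cvg_trans (cf x Ux).
  by apply: near_eq_cvg; exact: nU Ux.
move=> [df Df]; split.
  by move=> x Ux; apply: near_eq_differentiable (df x Ux); exact: nU.
by move=> v; apply: IH (Df v) => x Ux; apply: near_eq_derive; exact: nU.
Unshelve. all: by end_near. Qed.

Lemma Ck_local (W : normedModType R) k (U : set V) (f : V -> W) :
  (forall x, U x -> exists2 B, B x & Ck k B f) -> Ck k U f.
Proof.
elim: k f => [|k IH] f /= Uf.
  by move=> x Ux; have [B Bx] := Uf x Ux; apply.
split; first by move=> x Ux; have [B Bx [+ _]] := Uf x Ux; apply.
move=> v; apply: IH => x Ux; have [B Bx [_ Df]] := Uf x Ux; by exists B.
Qed.

Lemma Ck_sub (W : normedModType R) k (U B : set V) (f : V -> W) :
  B `<=` U -> Ck k U f -> Ck k B f.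
Proof. by move=> BU Uf; apply: Ck_local => x /BU Ux; exists U. Qed.

Lemma CkS (W : normedModType R) k (U : set V) (f : V -> W) :
  Ck k.+1 U f -> Ck k U f.
Proof.
elim: k f => [|k IH] f [df Df].
  by move=> x Ux; apply: differentiable_continuous; exact: df.
by split=> // v; apply: IH; exact: Df.
Qed.

Lemma Ck_cst (W : normedModType R) k (U : set V) (a : W) : Ck k U (cst a).
Proof.
elim: k a => [|k IH] a /=; first by move=> x _; exact: cst_continuous.
split; first by move=> x _; exact: differentiable_cst.
move=> v; rewrite (_ : 'D_v (cst a) = cst 0)//.
by apply/funext => x; rewrite derive_cst.
Qed.

Lemma Ck_add (W : normedModType R) k (U : set V) (f g : V -> W) :
  open U -> Ck k U f -> Ck k U g -> Ck k U (f + g).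
Proof.
move=> oU; elim: k f g => [|k IH] f g /=.
  by move=> cf cg x Ux; apply: continuousD; [exact: cf|exact: cg].
move=> [df Df] [dg Dg]; split.
  by move=> x Ux; apply: differentiableD; [exact: df|exact: dg].
move=> v; apply: (Ck_eq oU _ (IH _ _ (Df v) (Dg v))) => x Ux.
by rewrite deriveD //; apply: diff_derivable; [exact: df|exact: dg].
Qed.

Lemma Ck_mul k (U : set V) (f g : V -> R) :
  open U -> Ck k U f -> Ck k U g -> Ck k U (f * g).
Proof.
move=> oU; elim: k f g => [|k IH] f g.
  by move=> cf cg x Ux; apply: continuousM; [exact: cf|exact: cg].
move=> Cf Cg; have [df Df] := Cf; have [dg Dg] := Cg; split.
  by move=> x Ux; apply: differentiableM; [exact: df|exact: dg].
move=> v.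
have Cfg := Ck_add oU (IH _ _ (CkS Cf) (Dg v)) (IH _ _ (CkS Cg) (Df v)).
apply: (Ck_eq oU _ Cfg) => x Ux.
by rewrite deriveM //; apply: diff_derivable; [exact: df|exact: dg].
Qed.

Lemma Ck_sum k (U : set V) n (f : 'I_n -> V -> R) :
  open U -> (forall i, Ck k U (f i)) -> Ck k U (\sum_i f i).
Proof.
move=> oU Cf; elim/big_ind : _ => //; first exact: Ck_cst.
by move=> ? ?; exact: Ck_add.
Qed.

Lemma Ck_coord k (U : set V) n (f : V -> 'rV[R]_n) i :
  open U -> Ck k U f -> Ck k U (fun x => f x ord0 i).
Proof.
move=> oU; elim: k f => [|k IH] f.
  move=> cf x Ux; apply: (@continuous_comp _ _ _ f (fun M => M ord0 i)).
    exact: cf.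
  exact: coord_continuous.
move=> [df Df]; split.
  move=> x Ux.
  apply: (@differentiable_comp _ _ _ _ f (fun M : 'rV[R]_n => M ord0 i : R)).
    exact: df.
  exact: differentiable_coord.
move=> v; apply: (Ck_eq oU _ (IH _ (Df v))) => x Ux.
by rewrite derive_mx ?mxE //; apply: diff_derivable; exact: df.
Qed.

Lemma Ck_comp k n (U : set V) (B : set 'rV[R]_n) (f : 'rV[R]_n -> R)
    (g : V -> 'rV[R]_n) :
  open U -> open B -> (forall x, U x -> B (g x)) ->
  Ck k B f -> Ck k U g -> Ck k U (f \o g).
Proof.
move=> oU oB gU; elim: k f g gU => [|k IH] f g gU.
  by move=> cf cg x Ux; apply: continuous_comp; [exact: cg|exact/cf/gU].
move=> Cf Cg; have [df Df] := Cf; have [dg Dg] := Cg; split.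
  by move=> x Ux; apply: differentiable_comp; [exact: dg|exact/df/gU].
move=> v.
pose h := \sum_(i < n)
  ((fun x => 'D_v g x ord0 i) * ('D_(delta_mx 0 i) f \o g) : V -> R).
have Ch : Ck k U h.
  apply: Ck_sum => // i; apply: Ck_mul => //; first exact: (Ck_coord i oU (Dg v)).
  by apply: IH gU (Df _) (CkS Cg).
apply: (Ck_eq oU _ Ch) => x Ux.
have dgx := dg x Ux; have dfx := df _ (gU x Ux).
rewrite deriveE; last exact: differentiable_comp.
rewrite diff_comp //= -(deriveE _ dgx) [in RHS](row_sum_delta ('D_v g x)).
rewrite linear_sum /h fct_sumE; apply: eq_bigr => i _.
rewrite linearZ /= -(deriveE _ dfx). by [].
Qed.
End Ck_lemmas.

(* cfun and cinv are total functions, meaningful on cdom and cfun @` cdom only. *)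
Record chart (R : realType) (n : nat) (T : topologicalType) := Chart {
  cdom : set T;
  cfun : T -> 'rV[R]_n;
  cinv : 'rV[R]_n -> T;
  cdom_open : open cdom;
  cimg_open : open (cfun @` cdom);
  cfunK : forall x, cdom x -> cinv (cfun x) = x;
  cfun_cont : forall x, cdom x -> {for x, continuous cfun};
  cinv_cont : forall y, (cfun @` cdom) y -> {for y, continuous cinv} }.

Record manifold (R : realType) (n : nat) := Manifold {
  point_of :> topologicalType;
  atlas : set (chart R n point_of);
  mfd_hausdorff : hausdorff_space point_of;
  mfd_second_countable : @second_countable point_of;
  atlas_cover : forall x : point_of, exists2 c, atlas c & cdom c x;
  atlas_compat : forall c d, atlas c -> atlas d ->
    smooth_on (cfun c @` (cdom c `&` cdom d)) (cfun d \o cinv c) }.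

Definition smooth_fun (R : realType) n (M : manifold R n) (f : M -> R) : Prop :=
  forall c, atlas c -> smooth_on (cfun c @` cdom c) (f \o cinv c).

Definition smooth_map (R : realType) m n (M : manifold R m) (N : manifold R n)
    (u : M -> N) : Prop :=
  continuous u /\ forall (c : chart R m M) (d : chart R n N),
    atlas c -> atlas d ->
    smooth_on (cfun c @` (cdom c `&` u @^-1` cdom d)) (cfun d \o u \o cinv c).

Lemma chart_img_open (R : realType) n (T : topologicalType) (c : chart R n T) A :
  open A -> open (cfun c @` (cdom c `&` A)).
Proof.
move=> oA; rewrite openE => _ [p [cp Ap] <-].
have ip : (cfun c @` cdom c) (cfun c p) by exists p.
have nA : \forall y \near cfun c p, A (cinv c y).
  by apply: (cinv_cont ip); rewrite cfunK //; exact: open_nbhs_nbhs.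
have nc : \forall y \near cfun c p, (cfun c @` cdom c) y.
  by apply: open_nbhs_nbhs; split => //; exact: cimg_open.
near=> y; have [q cq yE] : (cfun c @` cdom c) y by near: y.
exists q => //; split => //; rewrite -(cfunK cq) yE; near: y; exact: nA.
Unshelve. all: by end_near. Qed.

Lemma smooth_fun_comp (R : realType) m n (M : manifold R m) (N : manifold R n)
    (u : M -> N) (f : N -> R) :
  smooth_map u -> smooth_fun f -> smooth_fun (f \o u).
Proof.
move=> [cu su] sf c ac k; apply: Ck_local => _ [p cp <-].
have [d ad dp] := atlas_cover (u p).
exists (cfun c @` (cdom c `&` u @^-1` cdom d)); first by exists p.
have oB : open (cfun c @` (cdom c `&` u @^-1` cdom d)).
  apply: chart_img_open; apply: open_comp; last exact: cdom_open.
  by move=> x _; exact: cu.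
apply: (@Ck_eq _ _ _ _ _ ((f \o cinv d) \o (cfun d \o u \o cinv c))) => //.
  move=> _ [q [cq dq] <-]; rewrite /= !cfunK //.
apply: (@Ck_comp _ _ _ _ _ (cfun d @` cdom d)) => //.
- exact: cimg_open.
- by move=> _ [q [cq dq] <-] /=; rewrite cfunK //; exists (u q).
- exact: sf.
- exact: su.
Qed.

Section smooth_functions.
Variables (R : realType) (n : nat) (M : manifold R n).

Definition smooth_pred : {pred M -> R} := fun f => `[< smooth_fun f >].

Fact smooth_pred_subalg :
  1 \in smooth_pred /\
  (forall a, {in smooth_pred &, forall f g, a *: f + g \in smooth_pred}) /\
  {in smooth_pred &, forall f g, f * g \in smooth_pred}.
Proof.
split; first by apply/asboolP => c ac k; exact: Ck_cst.
split=> [a|] f g /asboolP sf /asboolP sg; apply/asboolP => c ac k.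
  apply: Ck_add; [exact: cimg_open| |exact: sg].
  apply: (@Ck_mul _ _ _ _ (cst a)); [exact: cimg_open|exact: Ck_cst|exact: sf].
apply: Ck_mul; [exact: cimg_open|exact: sf|exact: sg].
Qed.

Fact smooth_pred_subring : subring_closed smooth_pred.
Proof.
have [s1 [sL sM]] := smooth_pred_subalg; split=> // f g sf sg.
by rewrite addrC -scaleN1r; exact: sL.
Qed.

Fact smooth_pred_submod : submod_closed smooth_pred.
Proof.
have [s1 [sL sM]] := smooth_pred_subalg; split => [|a f g]; last exact: sL.
by rewrite -(addNr 1) -scaleN1r; exact: sL.
Qed.

HB.instance Definition _ :=
  GRing.isSubringClosed.Build (M -> R) smooth_pred smooth_pred_subring.
HB.instance Definition _ :=
  GRing.isSubmodClosed.Build R (M -> R) smooth_pred smooth_pred_submod.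

(* C^oo(M); possibly the zero ring, as M may be empty. *)
Record Cinf := MkCinf { Cinf_fun :> M -> R; _ : Cinf_fun \in smooth_pred }.

HB.instance Definition _ := [isSub for Cinf_fun].
HB.instance Definition _ := [Choice of Cinf by <:].
HB.instance Definition _ :=
  GRing.SubChoice_isSubComPzRing.Build _ _ Cinf (subringClosedP _).
HB.instance Definition _ := [SubZmodule_isSubLmodule of Cinf by <:].

End smooth_functions.

Definition mkCinf (R : realType) n (M : manifold R n) (f : M -> R)
  (sf : smooth_fun f) : Cinf M := MkCinf (asboolT sf).

Lemma CinfP (R : realType) n (M : manifold R n) (f : Cinf M) : smooth_fun f.
Proof. by case: f => f /= /asboolP. Qed.

Lemma Cinf_inj (R : realType) n (M : manifold R n) (f g : Cinf M) :
  (forall p, f p = g p) -> f = g.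
Proof. by move=> fg; apply: val_inj; apply/funext. Qed.

Section tangent_space.
Variables (R : realType) (n : nat) (M : manifold R n) (p : M).

Definition derivation_at : {pred Cinf M -> R} := fun v =>
  `[< (forall (a : R) (f g : Cinf M), v (a *: f + g) = a * v f + v g) /\
      (forall f g : Cinf M, v (f * g) = f p * v g + g p * v f) >].

Fact derivation_at_submod : submod_closed derivation_at.
Proof.
split=> [|a v w /asboolP[vL vM] /asboolP[wL wM]]; apply/asboolP.
  have E f : (0 : Cinf M -> R) f = 0 by [].
  by split=> *; rewrite !E !mulr0 addr0.
have E f : (a *: v + w) f = a * v f + w f by [].
by split=> *; rewrite !E ?vL ?wL ?vM ?wM; ring.
Qed.

HB.instance Definition _ :=
  GRing.isSubmodClosed.Build R (Cinf M -> R) derivation_at derivation_at_submod.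

(* Tangent vectors at p are the derivations of C^oo(M) at p. *)
Record tangent := MkTangent {
  tangent_fun :> Cinf M -> R; _ : tangent_fun \in derivation_at }.

HB.instance Definition _ := [isSub for tangent_fun].
HB.instance Definition _ := [Choice of tangent by <:].
HB.instance Definition _ :=
  GRing.SubChoice_isSubZmodule.Build _ _ tangent (zmodClosedP _).
HB.instance Definition _ := [SubZmodule_isSubLmodule of tangent by <:].

Definition mkTangent (v : Cinf M -> R)
    (vL : forall (a : R) f g, v (a *: f + g) = a * v f + v g)
    (vM : forall f g, v (f * g) = f p * v g + g p * v f) : tangent :=
  MkTangent (asboolT (conj vL vM)).

Lemma tangentL (v : tangent) (a : R) (f g : Cinf M) :
  v (a *: f + g) = a * v f + v g.
Proof. by case: v => v /= /asboolP[]. Qed.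

Lemma tangentM (v : tangent) (f g : Cinf M) :
  v (f * g) = f p * v g + g p * v f.
Proof. by case: v => v /= /asboolP[]. Qed.

Lemma tangent_inj (v w : tangent) : (forall f : Cinf M, v f = w f) -> v = w.
Proof. by move=> vw; apply: val_inj; apply/funext. Qed.

Lemma tangentDE (v w : tangent) f : (v + w) f = v f + w f.
Proof. by []. Qed.
Lemma tangentNE (v : tangent) f : (- v) f = - v f.
Proof. by []. Qed.
Lemma tangentZE a (v : tangent) f : (a *: v) f = a * v f.
Proof. by []. Qed.
Lemma tangent0E f : (0 : tangent) f = 0.
Proof. by []. Qed.

End tangent_space.

Section sections_along.
Variables (R : realType) (m n : nat) (M : manifold R m) (N : manifold R n).
Variable u : M -> N.

(* Gamma(u^-1 TN).  By bump functions, V is smooth in charts iff V f is smooth for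
   every f in C^oo(N).  Vector fields are the sections along the identity map. *)
Record section := MkSection {
  section_fun :> forall p : M, tangent (u p);
  section_smooth : forall f : Cinf N, smooth_fun (fun p => section_fun p f) }.

Definition section_act (V : section) (f : Cinf N) : Cinf M :=
  mkCinf (section_smooth V f).

Lemma section_inj (V W : section) : (forall p, V p = W p) -> V = W.
Proof.
case: V W => V sV [W sW] /= VW.
have E : V = W by apply/functional_extensionality_dep.
by subst W; congr MkSection; exact: Prop_irrelevance.
Qed.

HB.instance Definition _ := gen_eqMixin section.
HB.instance Definition _ := gen_choiceMixin section.

Fact section0_smooth f : smooth_fun (fun p => (0 : tangent (u p)) f).
Proof. exact: (CinfP (0 : Cinf M)). Qed.
Fact sectionN_smooth (V : section) f : smooth_fun (fun p => (- V p) f).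
Proof. exact: (CinfP (- section_act V f)). Qed.
Fact sectionD_smooth (V W : section) f : smooth_fun (fun p => (V p + W p) f).
Proof. exact: (CinfP (section_act V f + section_act W f)). Qed.
Fact sectionZ_smooth (a : Cinf M) (V : section) f :
  smooth_fun (fun p => (a p *: V p) f).
Proof. exact: (CinfP (a * section_act V f)). Qed.

Definition section0 := MkSection section0_smooth.
Definition sectionN V := MkSection (sectionN_smooth V).
Definition sectionD V W := MkSection (sectionD_smooth V W).
Definition sectionZ a V := MkSection (sectionZ_smooth a V).

Fact sectionDA : associative sectionD.
Proof. by move=> *; apply: section_inj => p; exact: addrA. Qed.
Fact sectionDC : commutative sectionD.
Proof. by move=> *; apply: section_inj => p; exact: addrC. Qed.
Fact section0D : left_id section0 sectionD.
Proof. by move=> *; apply: section_inj => p; exact: add0r. Qed.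
Fact sectionND : left_inverse section0 sectionN sectionD.
Proof. by move=> *; apply: section_inj => p; exact: addNr. Qed.

HB.instance Definition _ :=
  GRing.isZmodule.Build section sectionDA sectionDC section0D sectionND.

Fact sectionZA a b V : sectionZ a (sectionZ b V) = sectionZ (a * b) V.
Proof. by apply: section_inj => p; exact: scalerA. Qed.
Fact section1Z : left_id 1 sectionZ.
Proof. by move=> V; apply: section_inj => p; exact: scale1r. Qed.
Fact sectionZDr : right_distributive sectionZ +%R.
Proof. by move=> a V W; apply: section_inj => p; exact: scalerDr. Qed.
Fact sectionZDl V : {morph sectionZ^~ V : a b / a + b}.
Proof. by move=> a b; apply: section_inj => p; exact: scalerDl. Qed.

HB.instance Definition _ := GRing.Zmodule_isLmodule.Build (Cinf M) section
  sectionZA section1Z sectionZDr sectionZDl.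

End sections_along.

Notation vfield M := (section (fun x : M => x)).

Section bracket.
Variables (R : realType) (n : nat) (M : manifold R n).
Implicit Types X Y : vfield M.

Fact section_actL X (a : R) (f g : Cinf M) :
  section_act X (a *: f + g) = a *: section_act X f + section_act X g.
Proof. by apply: Cinf_inj => p; exact: tangentL. Qed.

Fact section_actM X (f g : Cinf M) :
  section_act X (f * g) = f * section_act X g + g * section_act X f.
Proof. by apply: Cinf_inj => p; exact: tangentM. Qed.

Definition bracket_at X Y (p : M) (f : Cinf M) : R :=
  X p (section_act Y f) - Y p (section_act X f).

Fact bracket_atL X Y p a f g :
  bracket_at X Y p (a *: f + g) = a * bracket_at X Y p f + bracket_at X Y p g.
Proof. by rewrite /bracket_at !section_actL !tangentL mulrBr opprD addrACA. Qed.

Fact bracket_atM X Y p f g :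
  bracket_at X Y p (f * g) =
  f p * bracket_at X Y p g + g p * bracket_at X Y p f.
Proof.
have D (Z : vfield M) (a b : Cinf M) : Z p (a + b) = Z p a + Z p b.
  by have := tangentL (Z p) 1 a b; rewrite scale1r mul1r.
rewrite /bracket_at !section_actM !D !tangentM /= !mulrBr.
by ring.
Qed.

Definition bracket X Y : vfield M :=
  @MkSection _ _ _ _ _ _
    (fun p => mkTangent (bracket_atL X Y p) (bracket_atM X Y p))
    (fun f => CinfP (section_act X (section_act Y f) -
                     section_act Y (section_act X f))).

End bracket.

Record smap (R : realType) m n (M : manifold R m) (N : manifold R n) := Smap {
  smap_fun :> M -> N; smapP : smooth_map smap_fun }.

Section differential.
Variables (R : realType) (m n : nat) (M : manifold R m) (N : manifold R n).
Variable u : smap M N.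

Definition Cinf_comp (f : Cinf N) : Cinf M :=
  mkCinf (smooth_fun_comp (smapP u) (CinfP f)).

Definition tdiff_fun p (x : tangent p) (f : Cinf N) : R := x (Cinf_comp f).

Fact tdiff_funL p (x : tangent p) (a : R) f g :
  tdiff_fun x (a *: f + g) = a * tdiff_fun x f + tdiff_fun x g.
Proof. by rewrite -tangentL; congr (x _); exact: Cinf_inj. Qed.

Fact tdiff_funM p (x : tangent p) f g :
  tdiff_fun x (f * g) = f (u p) * tdiff_fun x g + g (u p) * tdiff_fun x f.
Proof.
rewrite -[LHS]/(x (Cinf_comp (f * g))).
by rewrite (_ : Cinf_comp _ = Cinf_comp f * Cinf_comp g) ?tangentM;
  last exact: Cinf_inj.
Qed.

(* u_* on tangent vectors; push below is u_* on vector fields, with values in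
   Gamma(u^-1 TN), and pull sends Y to Y o u. *)
Definition tdiff p (x : tangent p) : tangent (u p) :=
  mkTangent (tdiff_funL x) (tdiff_funM x).

Definition push (X : vfield M) : section u :=
  @MkSection _ _ _ _ _ u (fun p => tdiff (X p))
    (fun f => CinfP (section_act X (Cinf_comp f))).

Definition pull (Y : vfield N) : section u :=
  @MkSection _ _ _ _ _ u (fun p => Y (u p))
    (fun f => CinfP (Cinf_comp (section_act Y f))).

End differential.

(* Linear connections on u^-1 TN; an affine connection on M is the case of the
   identity map.  Linearity over R in V follows from the Leibniz rule, since
   tangent vectors kill constants. *)
Record connection (R : realType) m n (M : manifold R m) (N : manifold R n)
    (u : M -> N) := Connection {
  cov : forall p : M, tangent p -> section u -> tangent (u p);
  covL : forall p (a : R) (x y : tangent p) V,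
    cov (a *: x + y) V = a *: cov x V + cov y V;
  covD : forall p (x : tangent p) V W, cov x (V + W) = cov x V + cov x W;
  covM : forall p (x : tangent p) (f : Cinf M) V,
    cov x (f *: V) = x f *: V p + f p *: cov x V;
  cov_smooth : forall (X : vfield M) V (f : Cinf N),
    smooth_fun (fun p => cov (X p) V f) }.

Notation affine_connection M := (connection (fun x : M => x)).

Definition nabla (R : realType) m n (M : manifold R m) (N : manifold R n)
    (u : M -> N) (D : connection u) (X : vfield M) (V : section u) : section u :=
  @MkSection _ _ _ _ _ u (fun p => cov D (X p) V) (cov_smooth D X V).

(* Du is the connection on u^-1 TN induced by D: it is the only connection with
   Du_x (Y o u) = D_(u_* x) Y. *)
Definition is_pullback (R : realType) m n (M : manifold R m) (N : manifold R n)
    (D : affine_connection N) (u : smap M N) (Du : connection u) : Prop :=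
  forall p (x : tangent p) (Y : vfield N),
    cov Du x (pull u Y) = cov D (tdiff u x) Y.

Record metric (R : realType) n (M : manifold R n) := Metric {
  metric_at :> forall p : M, tangent p -> tangent p -> R;
  metricL : forall p (a : R) (x y z : tangent p),
    metric_at (a *: x + y) z = a * metric_at x z + metric_at y z;
  metricC : forall p (x y : tangent p), metric_at x y = metric_at y x;
  metric_gt0 : forall p (x : tangent p), x != 0 -> 0 < metric_at x x;
  metric_smooth : forall X Y : vfield M,
    smooth_fun (fun p => metric_at (X p) (Y p)) }.

Section statistical_structures.
Variables (R : realType) (n : nat) (M : manifold R n).
Implicit Types (g : metric M) (D : affine_connection M) (X Y Z W : vfield M).

Definition mpair g X Y : Cinf M := mkCinf (metric_smooth g X Y).

Definition torsion_free D : Prop :=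
  forall X Y, nabla D X Y - nabla D Y X = bracket X Y.

(* (D_X g)(Y, Z) *)
Definition cov_metric D g X Y Z : Cinf M :=
  section_act X (mpair g Y Z) - mpair g (nabla D X Y) Z - mpair g Y (nabla D X Z).

Definition statistical g D : Prop :=
  torsion_free D /\ forall X Y Z, cov_metric D g X Y Z = cov_metric D g Y X Z.

Definition levi_civita g D : Prop :=
  torsion_free D /\ forall X Y Z, cov_metric D g X Y Z = 0.

Definition conjugate g D D' : Prop := forall X Y Z,
  section_act X (mpair g Y Z) = mpair g (nabla D X Y) Z + mpair g Y (nabla D' X Z).

Definition curv D X Y Z : vfield M :=
  nabla D X (nabla D Y Z) - nabla D Y (nabla D X Z) - nabla D (bracket X Y) Z.

Definition hessian g D : Prop :=
  statistical g D /\ forall X Y Z, curv D X Y Z = 0.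

(* L Z W X stands for L(Z, W)X; the equation determines L, as g is definite. *)
Definition is_curv_op g D (L : vfield M -> vfield M -> vfield M -> vfield M) : Prop :=
  forall X Y Z W, mpair g (L Z W X) Y = mpair g (curv D X Y Z) W.

Definition diff_tensor D D0 X Y : vfield M := nabla D X Y - nabla D0 X Y.

(* cov2 D T X Y Z = (D_X T)(Y, Z), cov3 D T X Y Z W = (D_X T)(Y, Z, W) *)
Definition cov2 D (T : vfield M -> vfield M -> vfield M) X Y Z : vfield M :=
  nabla D X (T Y Z) - T (nabla D X Y) Z - T Y (nabla D X Z).

Definition cov3 D (T : vfield M -> vfield M -> vfield M -> vfield M) X Y Z W :
    vfield M :=
  nabla D X (T Y Z W) - T (nabla D X Y) Z W - T Y (nabla D X Z) W
  - T Y Z (nabla D X W).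

(* A smooth vector field through a given tangent vector.  One always exists (cut
   off a local one with a bump function); 0 is only a default for xget. *)
Definition ext (p : M) (x : tangent p) : vfield M := 
  xget (0 : vfield M) [set X : vfield M | X p = x].

(* Value at p of a tensor field given by its action on vector fields; by
   C^oo-multilinearity of T it does not depend on the chosen extensions. *)
Definition at3 (T : vfield M -> vfield M -> vfield M -> vfield M) p
    (x y z : tangent p) : tangent p := T (ext x) (ext y) (ext z) p.

Definition at4 (T : vfield M -> vfield M -> vfield M -> vfield M -> vfield M) p
    (x y z w : tangent p) : tangent p := T (ext x) (ext y) (ext z) (ext w) p.

(* H(y, z; x), where D0 is the Levi-Civita connection *)
Definition hess_curv D D0 p (y z x : tangent p) : tangent p :=
  at3 (cov2 D (diff_tensor D D0)) x y z.

Definition const_hess_curv g D D0 (c : R) : Prop :=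
  forall p (x y z : tangent p),
    hess_curv D D0 y z x = - (c / 2) *: (g p x y *: z + g p x z *: y).

(* The e i are global vector fields, orthonormal near p only: each local
   orthonormal frame agrees near p with such a family. *)
Definition orthonormal_near g (p : M) (e : 'I_n -> vfield M) : Prop :=
  \forall q \near p, forall i j, g q (e i q) (e j q) = (i == j)%:R.

End statistical_structures.

Section maps.
Variables (R : realType) (m n : nat) (M : manifold R m) (N : manifold R n).
Variable u : smap M N.

(* tau is the tension field of u for the connections D on M and Du on u^-1 TN; the
   sum does not depend on the frame, and frames exist near every point. *)
Definition is_tension (g : metric M) (D : affine_connection M)
    (Du : connection u) (tau : section u) : Prop :=
  forall p (e : 'I_m -> vfield M), orthonormal_near g p e ->
    tau p = \sum_i (cov Du (e i p) (push u (e i)) -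
                    tdiff u (cov D (e i p) (e i))).

(* The value at p of H_u(V), computed in the frame e.  D, Dh and Db are nabla^N,
   nabla^h and the conjugate connection of nabla^N; Dbu is induced by Db; L and
   Lb are the curvature operators of D and Db. *)
Definition calH (D Dh Db : affine_connection N)
    (L Lb : vfield N -> vfield N -> vfield N -> vfield N)
    (Dbu : connection u) (tau taub : section u)
    (e : 'I_m -> vfield M) (V : section u) (p : M) : tangent (u p) :=
  let Rb := curv Db in
  let K := diff_tensor D Dh in
  let ue i := tdiff u (e i p) in
  at3 Rb (V p) (taub p) (tau p)
  + \sum_i at4 (cov3 Db Rb) (ue i) (V p) (ue i) (tau p)
  + 2 *: \sum_i at3 Rb (V p) (ue i) (cov Dbu (e i p) tau)
  + \sum_i at4 (cov3 Db Lb) (V p) (tau p) (ue i) (ue i)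
  - 2 *: \sum_i at3 L (ue i) (tau p) (cov Dbu (e i p) V)
  - at3 (cov2 Db K) (V p) (tau p) (tau p).

End maps.

(* Main.v *)
Require Import Defs.
From mathcomp Require Import all_boot all_order all_algebra.
From mathcomp Require Import boolp classical_sets functions reals topology.
From mathcomp Require Import ring lra.
Set Implicit Arguments.
Unset Strict Implicit.
Unset Printing Implicit Defensive.
Import GRing.Theory.
Local Open Scope ring_scope.

(** Every curvature term of calH vanishes, because conjugation preserves
    flatness.  Differentiating h(Z, W) twice with the conjugacy identity and
    antisymmetrising gives h(R(X, Y)Z, W) = - h(Z, Rb(X, Y)W)
    ([mpair_curv_conjugate]); so if the conjugate connection Db is flat, then D
    is flat too, and both curvature operators L and Lb vanish since h is definite.
    What is left of calH is the term - (Db_V K)(tau, tau) with K = D - Dh.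

    Conjugate torsion-free connections have the Levi-Civita connection as their
    mean ([conjugate_mean]), hence K = - (Db - Dh), and the surviving term is
    (Db_V (Db - Dh))(tau, tau), the Hessian curvature of (h, Db).

    The tensor fields that are compared coincide on all global vector fields, so
    they coincide on whichever extensions of tangent vectors are chosen to
    evaluate them at a point. *)

(** * Metrics, connections and vector fields *)

Section smooth_function_values.
Variables (R : realType) (n : nat) (M : manifold R n) (p : M).
Implicit Types f : Cinf M.

Lemma Cinf_zeroE : (0 : Cinf M) p = 0. Proof. by []. Qed.
Lemma Cinf_addE f1 f2 : (f1 + f2) p = f1 p + f2 p. Proof. by []. Qed.
Lemma Cinf_oppE f : (- f) p = - f p. Proof. by []. Qed.

Definition CinfE := (Cinf_zeroE, Cinf_addE, Cinf_oppE).

End smooth_function_values.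

Section metric_algebra.
Variables (R : realType) (n : nat) (M : manifold R n) (g : metric M).
Implicit Types X Y Z : vfield M.

Lemma mpairC X Y : mpair g X Y = mpair g Y X.
Proof. by apply: Cinf_inj => p; exact: metricC. Qed.

Lemma mpairDl X Y Z : mpair g (X + Y) Z = mpair g X Z + mpair g Y Z.
Proof.
apply: Cinf_inj => p; have := metricL g 1 (X p) (Y p) (Z p).
by rewrite scale1r mul1r.
Qed.

Lemma mpairDr X Y Z : mpair g Z (X + Y) = mpair g Z X + mpair g Z Y.
Proof. by rewrite mpairC mpairDl !(mpairC Z). Qed.

Lemma mpair0l Z : mpair g 0 Z = 0.
Proof. by apply: (addrI (mpair g 0 Z)); rewrite -mpairDl !addr0. Qed.

Lemma mpairNl X Z : mpair g (- X) Z = - mpair g X Z.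
Proof. by apply: (addrI (mpair g X Z)); rewrite -mpairDl !subrr mpair0l. Qed.

Lemma mpairNr X Z : mpair g Z (- X) = - mpair g Z X.
Proof. by rewrite mpairC mpairNl mpairC. Qed.

Lemma mpair_nondegenerate X : (forall Y, mpair g X Y = 0) -> X = 0.
Proof.
move=> X0; apply: section_inj => p; apply/eqP; apply: contraT => Xp0.
have := metric_gt0 g Xp0.
by rewrite -[g p _ _]/(mpair g X X p) X0 Order.POrderTheory.ltxx.
Qed.

End metric_algebra.

Section connection_algebra.
Variables (R : realType) (n : nat) (M : manifold R n).
Implicit Types (D : affine_connection M) (X Y V W : vfield M).

Lemma section_actD X (f1 f2 : Cinf M) :
  section_act X (f1 + f2) = section_act X f1 + section_act X f2.
Proof. by have := section_actL X 1 f1 f2; rewrite !scale1r. Qed.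

Lemma nablaD D X V W : nabla D X (V + W) = nabla D X V + nabla D X W.
Proof. by apply: section_inj => p; exact: covD. Qed.

Lemma nabla0 D X : nabla D X 0 = 0.
Proof. by apply: (addrI (nabla D X 0)); rewrite -nablaD !addr0. Qed.

Lemma nablaN D X V : nabla D X (- V) = - nabla D X V.
Proof. by apply: (addrI (nabla D X V)); rewrite -nablaD !subrr nabla0. Qed.

Lemma cov2_opp D (T S : vfield M -> vfield M -> vfield M) X Y Z :
  (forall V W, T V W = - S V W) -> cov2 D T X Y Z = - cov2 D S X Y Z.
Proof. by move=> TS; rewrite /cov2 !TS nablaN !opprD. Qed.

Lemma cov3_zero D (T : vfield M -> vfield M -> vfield M -> vfield M) X Y Z W :
  (forall U V V', T U V V' = 0) -> cov3 D T X Y Z W = 0.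
Proof. by move=> T0; rewrite /cov3 !T0 nabla0 !subr0. Qed.

End connection_algebra.

(** * Conjugate connections *)

Section conjugate_connections.
Variables (R : realType) (n : nat) (M : manifold R n) (g : metric M).
Variables D Db : affine_connection M.
Hypothesis D_conj : conjugate g D Db.
Implicit Types X Y Z W : vfield M.

(** X(Y g(Z, W)) expands into g(D_X D_Y Z, W) + g(Z, Db_X Db_Y W) and two mixed
    terms that are exchanged by X <-> Y, hence cancel in [X, Y] g(Z, W). *)
Lemma mpair_curv_conjugate X Y Z W :
  mpair g (curv D X Y Z) W = - mpair g Z (curv Db X Y W).
Proof.
have second X' Y' : section_act X' (section_act Y' (mpair g Z W)) =
    mpair g (nabla D X' (nabla D Y' Z)) W +
    mpair g (nabla D Y' Z) (nabla Db X' W) +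
    (mpair g (nabla D X' Z) (nabla Db Y' W) +
     mpair g Z (nabla Db X' (nabla Db Y' W))).
  by rewrite (D_conj Y') section_actD !D_conj.
apply: Cinf_inj => p.
have bXY : mpair g (nabla D (bracket X Y) Z) W p +
    mpair g Z (nabla Db (bracket X Y) W) p =
    section_act X (section_act Y (mpair g Z W)) p -
    section_act Y (section_act X (mpair g Z W)) p.
  rewrite -[RHS]/(section_act (bracket X Y) (mpair g Z W) p).
  by rewrite D_conj.
move: bXY; rewrite !second /curv !(mpairDl, mpairDr, mpairNl, mpairNr).
by rewrite !CinfE; lra.
Qed.

Lemma flat_conjugate :
  (forall X Y Z, curv Db X Y Z = 0) -> forall X Y Z, curv D X Y Z = 0.
Proof.
move=> Db0 X Y Z; apply: (@mpair_nondegenerate _ _ _ g) => W.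
by rewrite mpair_curv_conjugate Db0 mpairC mpair0l oppr0.
Qed.

(** The tensor A = D + Db - 2 D0 is symmetric since the three connections are
    torsion-free, and g(A(X, Y), Z) is skew in Y and Z since both D0 and the mean
    of D and Db preserve g.  A trilinear form with these two symmetries is zero. *)
Lemma conjugate_mean D0 : torsion_free D -> torsion_free Db ->
  levi_civita g D0 ->
  forall X Y, diff_tensor D D0 X Y = - diff_tensor Db D0 X Y.
Proof.
move=> tD tDb [t0 g0] X Y.
pose A X Y := diff_tensor D D0 X Y + diff_tensor Db D0 X Y.
suff A0 : A X Y = 0 by apply/eqP; rewrite -addr_eq0; apply/eqP.
have AC X' Y' : A X' Y' = A Y' X'.
  have swap D' : torsion_free D' ->
      nabla D' X' Y' = bracket X' Y' + nabla D' Y' X'.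
    by move=> tD'; rewrite -(tD' X' Y') subrK.
  have cancel_l (U V W : vfield M) : U + V - (U + W) = V - W.
    by rewrite opprD addrACA subrr add0r.
  by rewrite /A /diff_tensor !swap // !cancel_l.
have A_skew X' Y' Z' p : mpair g (A X' Y') Z' p = - mpair g (A X' Z') Y' p.
  have e0 := congr1 (fun f : Cinf M => f p) (g0 X' Y' Z').
  have e1 := congr1 (fun f : Cinf M => f p) (D_conj X' Y' Z').
  have e2 := congr1 (fun f : Cinf M => f p) (D_conj X' Z' Y').
  move: e0 e1 e2; rewrite /cov_metric /A /diff_tensor (mpairC g Z' Y').
  rewrite !(mpairDl, mpairDr, mpairNl, mpairNr) !(mpairC g Y') !(mpairC g Z').
  by rewrite !CinfE; lra.
apply: (@mpair_nondegenerate _ _ _ g) => Z; apply: Cinf_inj => p.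
have e1 := A_skew X Y Z p.
have e2 := A_skew Z X Y p.
have e3 := A_skew Y Z X p.
move: e1 e2 e3; rewrite (AC Z X) (AC Z Y) (AC Y X) CinfE; lra.
Qed.

End conjugate_connections.

Lemma curv_op_flat (R : realType) n (M : manifold R n) (g : metric M)
    (D : affine_connection M) (L : vfield M -> vfield M -> vfield M -> vfield M) :
  is_curv_op g D L -> (forall X Y Z, curv D X Y Z = 0) ->
  forall X Y Z, L X Y Z = 0.
Proof.
move=> LP D0 X Y Z; apply: (@mpair_nondegenerate _ _ _ g) => W.
by rewrite LP D0 mpair0l.
Qed.

(** * The operator calH for a Hessian target *)

Theorem corollary5p4 (R : realType) (m n : nat)
    (M : manifold R m) (N : manifold R n) (g : metric M) (h : metric N)
    (DM DMb : affine_connection M) (DN DNb Dh : affine_connection N)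
    (LN LNb : vfield N -> vfield N -> vfield N -> vfield N) :
  statistical g DM -> conjugate g DM DMb ->
  statistical h DN -> conjugate h DN DNb -> levi_civita h Dh ->
  is_curv_op h DN LN -> is_curv_op h DNb LNb ->
  hessian h DNb ->
  forall (u : smap M N) (Du Dub : connection u) (tau taub : section u),
  is_pullback DN Du -> is_pullback DNb Dub ->
  is_tension g DM Du tau -> is_tension g DMb Dub taub ->
  (forall (V : section u) (p : M) (e : 'I_m -> vfield M),
     orthonormal_near g p e ->
     calH DN Dh DNb LN LNb Dub tau taub e V p =
     hess_curv DNb Dh (tau p) (tau p) (V p)) /\
  (forall c : R, const_hess_curv h DNb Dh c ->
     forall (V : section u) (p : M) (e : 'I_m -> vfield M),
     orthonormal_near g p e ->
     h (u p) (calH DN Dh DNb LN LNb Dub tau taub e V p) (V p) =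
     - c * h (u p) (tau p) (V p) ^+ 2).
Proof.
move=> _ _ [tN _] conjN lcN LNP LNbP [[tNb _] flatb].
move=> u Du Dub tau taub _ _ _ _.
have L0 := curv_op_flat LNP (flat_conjugate conjN flatb).
have Lb0 := curv_op_flat LNbP flatb.
have calHE (V : section u) (p : M) (e : 'I_m -> vfield M) :
    calH DN Dh DNb LN LNb Dub tau taub e V p =
    hess_curv DNb Dh (tau p) (tau p) (V p).
  have at3_0 T (q : N) (x y z : tangent q) :
      (forall X Y Z, T X Y Z = 0) -> at3 T x y z = 0.
    by move=> T0; rewrite /at3 T0.
  have at4_0 T (q : N) (x y z w : tangent q) :
      (forall X Y Z, T X Y Z = 0) -> at4 (cov3 DNb T) x y z w = 0.
    by move=> T0; rewrite /at4 cov3_zero.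
  rewrite /calH /hess_curv at3_0 //.
  rewrite !big1; try by [move=> i _; exact: at3_0 | move=> i _; exact: at4_0].
  rewrite !scaler0 !addr0 subr0 sub0r /at3.
  rewrite (cov2_opp DNb _ _ _ (conjugate_mean conjN tN tNb lcN)).
  exact: opprK.
split=> [V p e _|c Hc V p e _]; first exact: calHE.
have hZl (q : N) a (x y : tangent q) : h q (a *: x) y = a * h q x y.
  have h0 : h q 0 y = 0.
    by have := metricL h 1 0 0 y; rewrite scaler0 addr0 mul1r; lra.
  by have := metricL h a x 0 y; rewrite addr0 h0 addr0.
rewrite calHE Hc hZl (metricL h) hZl !(metricC h (V p)).
by field.
Qed.
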